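(* For all integers $k\ge h\ge l\ge 1$, $$\widetilde{D}_2(e_ke_he_l)=6\left(\sum_{j=0}^{l-1}\sum_{i=0}^{h-1}(k-h+1+j+2i)\,e_{k+i+j}\,e_{h-1-i}\,e_{l-1-j}-\sum_{j=0}^{l-2}\sum_{i=1}^{l-1-j}(h-l+j+2i)\,e_{k+j}\,e_{h-1+i}\,e_{l-1-i-j}\right).$$
   Context: Let $n\ge 2$ and let $e_k=e_k(x_2,x_3,\dots,x_n)$ be the elementary symmetric polynomial of degree $k$ in the $n-1$ variables $x_2,\dots,x_n$ ($e_0=1$, and $e_k=0$ for $k<0$ or $k>n-1$). $\widetilde{D}_2=\sum_{i=1}^n x_i\partial_i^3$ with $\partial_i=\partial/\partial x_i$. Empty sums are zero. *)

(* Defs.v *)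
From HB Require Import structures.
From mathcomp Require Import all_boot all_order all_algebra.
From mathcomp Require Import mpoly.

Set Implicit Arguments.
Unset Strict Implicit.
Unset Printing Implicit Defensive.

Import GRing.Theory.
Local Open Scope ring_scope.

(* The variables x_1, ..., x_n are 'X_i for i : 'I_n, numbered from 0: the
   variable x_1 is 'X_i with i = 0, and x_2, ..., x_n are those with 0 < i. *)

(* The sum defining mesym, restricted to the variables indexed by S. *)
Definition esym_on (n : nat) (R : comNzRingType) (S : {set 'I_n}) (k : nat) :
    {mpoly R[n]} :=
  \sum_(A : {set 'I_n} | (A \subset S) && (#|A| == k)) \prod_(i in A) 'X_i.

Definition esym_tail (n : nat) (R : comNzRingType) (k : nat) : {mpoly R[n]} :=
  esym_on R [set i : 'I_n | (0 < i)%N] k.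

Definition Dtilde2 (n : nat) (R : comNzRingType) (p : {mpoly R[n]}) :
    {mpoly R[n]} :=
  \sum_(i < n) 'X_i * p^`M(i, 3).

Lemma esym_tailE (m : nat) (R : comNzRingType) (k : nat) :
  esym_tail m.+1 R k =
  @mesym m R k \mPo [tuple 'X_(lift ord0 i) | i < m].
Proof.
have injl : injective (lift (@ord0 m)) by exact: lift_inj.
have imK (B : {set 'I_m}) : lift ord0 @^-1: (lift ord0 @: B) = B.
  by apply/setP => i; rewrite inE mem_imset.
rewrite /esym_tail /esym_on /mesym [RHS]raddf_sum /=.
rewrite (reindex_onto (fun B : {set 'I_m} => lift ord0 @: B)
                      (fun A : {set 'I_m.+1} => lift ord0 @^-1: A)) /=; last first.
  move=> A /andP[/subsetP sA _]; apply/setP => i.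
  apply/imsetP/idP => [[j + ->]|iA]; first by rewrite inE.
  have := sA _ iA; rewrite inE; case: (unliftP ord0 i) => [j|] ei; last first.
    by rewrite ei ltnn.
  by move=> _; exists j => //; rewrite inE -ei.
apply: eq_big => [B|B _].
  rewrite imK eqxx andbT card_imset //; case: (#|B| == k); rewrite ?andbF //.
  by rewrite andbT; apply/subsetP => i /imsetP[j _ ->]; rewrite inE.
rewrite big_imset /=; last by move=> x y _ _; apply: injl.
rewrite rmorph_prod /=; apply: eq_bigr => i _.
by rewrite comp_mpolyXU -tnth_nth tnth_mktuple.
Qed.

(* Main.v *)
Require Import Defs.
From HB Require Import structures.
From mathcomp Require Import all_boot all_order all_algebra.
From mathcomp Require Import mpoly ring zify.

Set Implicit Arguments.
Unset Strict Implicit.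
Unset Printing Implicit Defensive.

Import GRing.Theory.
Local Open Scope ring_scope.

(** Each [e k] has degree at most one in every variable, so the only terms of
    the third derivative of [e k * e h * e l] in x_i that survive are the six
    in which each factor is differentiated once: the left-hand side is
    6 T(k, h, l), where T(k, h, l) sums x_i (d_i e_k) (d_i e_h) (d_i e_l) over
    the variables.

    Splitting off x_i gives e_k = d_i e_(k+1) + x_i d_i e_k.  Replacing either
    x_i d_i e_a or x_i d_i e_b by means of this relation in
    x_i (d_i e_a) (d_i e_b) yields the exchange rule
      (d_i e_a) (d_i e_(b+1))
        = (d_i e_(a+1)) (d_i e_b) + e_b d_i e_a - e_a d_i e_b
    ([mderiv_esym_exchange]).
    Multiplied by x_i, or by x_i d_i e_c, and summed over i, the rule moves one
    unit of degree from one factor to another at the cost of a sum with one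
    derivative fewer.  The sum with one derivative is k e_k, by Euler's identity
    ([euler_esym_on]).  Since d_i e_0 = 0, iterating the transfer until an index
    reaches 0 evaluates first the sum with two derivatives
    ([sum_mderiv_esym2E]), then T ([sum_mderiv_esym3E]) in terms of the former,
    and substitution gives the double sums. *)

(** * Derivatives of elementary symmetric polynomials *)

Lemma mderiv_var (n : nat) (R : comNzRingType) (i : 'I_n) :
  ('X_i : {mpoly R[n]})^`M(i) = 1.
Proof.
rewrite mderivX mnm1E eqxx scale1r -mpolyX0; congr 'X_[_].
by apply/mnmP => j; rewrite mnmBE subnn mnm0E.
Qed.

Lemma mderiv_prodX (n : nat) (R : comNzRingType) (A : {set 'I_n}) (i : 'I_n) :
  i \notin A -> (\prod_(j in A) 'X_j : {mpoly R[n]})^`M(i) = 0.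
Proof.
move=> niA; apply: (big_ind (fun p : {mpoly R[n]} => p^`M(i) = 0)).
- by rewrite -mpolyC1 mderivC.
- by move=> p q dp dq; rewrite mderivM dp dq mul0r mulr0 addr0.
move=> j jA; rewrite mderivX mnm1E; case: eqP => [ji|_].
  by rewrite -ji jA in niA.
by rewrite scale0r.
Qed.

Lemma mderiv_esym_on_notin (n : nat) (R : comNzRingType) (S : {set 'I_n})
    (i : 'I_n) (k : nat) :
  i \notin S -> (esym_on R S k)^`M(i) = 0.
Proof.
move=> niS; rewrite /esym_on linear_sum big1 //= => A /andP[sAS _].
by apply: mderiv_prodX; apply: contra niS; apply: (subsetP sAS).
Qed.

Lemma esym_on_setD1 (n : nat) (R : comNzRingType) (S : {set 'I_n})
    (i : 'I_n) (k : nat) :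
  i \in S ->
  esym_on R S k.+1 = esym_on R (S :\ i) k.+1 + 'X_i * esym_on R (S :\ i) k.
Proof.
move=> iS; rewrite /esym_on (bigID (fun A : {set 'I_n} => i \notin A)) /=.
congr (_ + _).
  by apply: eq_bigl => A; rewrite subsetD1 andbAC.
rewrite (reindex_onto (fun B : {set 'I_n} => i |: B)
                      (fun A : {set 'I_n} => A :\ i)) /=; last first.
  by move=> A /andP[_]; rewrite negbK => iA; rewrite setD1K.
rewrite mulr_sumr; apply: eq_big => [B|B].
  rewrite setU11 /= andbT subsetD1 subUset sub1set iS /=.
  case: (boolP (i \in B)) => iB /=.
    rewrite andbF; apply/negbTE/negP => /andP[_ /eqP eB].
    by move: iB; rewrite -eB !inE eqxx.
  by rewrite setU1K // eqxx cardsU1 iB add1n eqSS !andbT.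
case/andP=> _ /eqP eB; rewrite (big_setD1 i) ?setU11 //=.
by rewrite eB.
Qed.

Lemma esym_on0 (n : nat) (R : comNzRingType) (S : {set 'I_n}) :
  esym_on R S 0 = 1.
Proof.
rewrite /esym_on (big_pred1 set0) ?big_set0 // => A /=.
by rewrite cards_eq0; case: eqP => [->|_]; rewrite ?sub0set ?andbF.
Qed.

Lemma mderiv_esym_on0 (n : nat) (R : comNzRingType) (S : {set 'I_n})
    (i : 'I_n) :
  (esym_on R S 0)^`M(i) = 0.
Proof. by rewrite esym_on0 -mpolyC1 mderivC. Qed.

Lemma mderiv_esym_onS (n : nat) (R : comNzRingType) (S : {set 'I_n})
    (i : 'I_n) (k : nat) :
  i \in S -> (esym_on R S k.+1)^`M(i) = esym_on R (S :\ i) k.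
Proof.
move=> iS; have niD : i \notin S :\ i by rewrite !inE eqxx.
rewrite (esym_on_setD1 R k iS) mderivD mderivM !mderiv_esym_on_notin //.
by rewrite mderiv_var mulr0 addr0 add0r mul1r.
Qed.

Lemma mderiv2_esym_on (n : nat) (R : comNzRingType) (S : {set 'I_n})
    (i : 'I_n) (k : nat) :
  (esym_on R S k)^`M(i)^`M(i) = 0.
Proof.
have [iS|niS] := boolP (i \in S); last by rewrite mderiv_esym_on_notin ?mderiv0.
case: k => [|k]; first by rewrite mderiv_esym_on0 mderiv0.
by rewrite mderiv_esym_onS // mderiv_esym_on_notin // !inE eqxx.
Qed.

(** This is [esym_on_setD1] with the polynomials in the remaining variables
    written as derivatives, so that no case distinction at degree 0 is left. *)
Lemma esym_on_mderiv (n : nat) (R : comNzRingType) (S : {set 'I_n})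
    (i : 'I_n) (k : nat) :
  i \in S ->
  esym_on R S k = (esym_on R S k.+1)^`M(i) + 'X_i * (esym_on R S k)^`M(i).
Proof.
move=> iS; rewrite mderiv_esym_onS //; case: k => [|k].
  by rewrite mderiv_esym_on0 mulr0 addr0 !esym_on0.
by rewrite mderiv_esym_onS // -esym_on_setD1.
Qed.

(** The two sides come from the two ways of eliminating [x_i] from
    [x_i (d_i e_a) (d_i e_b)] with [esym_on_mderiv]. *)
Lemma mderiv_esym_exchange (n : nat) (R : comNzRingType) (S : {set 'I_n})
    (i : 'I_n) (a b : nat) (e := esym_on R S) :
  i \in S ->
  (e a)^`M(i) * (e b.+1)^`M(i) =
  (e a.+1)^`M(i) * (e b)^`M(i) + e b * (e a)^`M(i) - e a * (e b)^`M(i).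
Proof.
move=> iS; have eaE := esym_on_mderiv R a iS; have ebE := esym_on_mderiv R b iS.
by rewrite -/e in eaE ebE; ring: eaE ebE.
Qed.

Lemma mulX_mderiv_prodX (n : nat) (R : comNzRingType) (A : {set 'I_n})
    (i : 'I_n) :
  i \in A ->
  'X_i * (\prod_(j in A) 'X_j : {mpoly R[n]})^`M(i) = \prod_(j in A) 'X_j.
Proof.
move=> iA; rewrite (big_setD1 i) //= mderivM mderiv_prodX ?inE ?eqxx //.
by rewrite mulr0 addr0 mderiv_var mul1r.
Qed.

(** Euler's identity: [x_i d_i] fixes a squarefree monomial that contains
    [x_i] and kills it otherwise, so each monomial of degree [k] is counted
    [k] times. *)
Lemma euler_esym_on (n : nat) (R : comNzRingType) (S : {set 'I_n}) (k : nat) :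
  \sum_(i in S) 'X_i * (esym_on R S k)^`M(i) = k%:R * esym_on R S k.
Proof.
rewrite /esym_on mulr_sumr.
under eq_bigr => i _ do rewrite linear_sum mulr_sumr.
rewrite exchange_big /=; apply: eq_bigr => A /andP[sAS /eqP <-].
rewrite (big_setID A) /= (setIidPr sAS) [X in _ + X]big1 ?addr0; last first.
  by move=> i /setDP[_ niA]; rewrite mderiv_prodX // mulr0.
under eq_bigr => i iA do rewrite mulX_mderiv_prodX //.
by rewrite sumr_const mulr_natl.
Qed.

(** * Sums of products of derivatives *)

Definition sum_mderiv_esym2 (n : nat) (R : comNzRingType) (S : {set 'I_n})
    (a b : nat) : {mpoly R[n]} :=
  \sum_(i in S) 'X_i * (esym_on R S a)^`M(i) * (esym_on R S b)^`M(i).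

Definition sum_mderiv_esym3 (n : nat) (R : comNzRingType) (S : {set 'I_n})
    (a b c : nat) : {mpoly R[n]} :=
  \sum_(i in S) 'X_i * (esym_on R S a)^`M(i) * (esym_on R S b)^`M(i) *
                (esym_on R S c)^`M(i).

Lemma sum_mderiv_esym2_0 (n : nat) (R : comNzRingType) (S : {set 'I_n})
    (a : nat) :
  sum_mderiv_esym2 R S a 0 = 0.
Proof. by apply: big1 => i _; rewrite mderiv_esym_on0 mulr0. Qed.

Lemma sum_mderiv_esym3_0 (n : nat) (R : comNzRingType) (S : {set 'I_n})
    (a b : nat) :
  sum_mderiv_esym3 R S a b 0 = 0.
Proof. by apply: big1 => i _; rewrite mderiv_esym_on0 mulr0. Qed.

Lemma sum_mderiv_esym2_exchange (n : nat) (R : comNzRingType) (S : {set 'I_n})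
    (a b : nat) (e := esym_on R S) :
  sum_mderiv_esym2 R S a b.+1 =
  sum_mderiv_esym2 R S a.+1 b + (a%:R - b%:R) * e a * e b.
Proof.
have -> : (a%:R - b%:R) * e a * e b =
          e b * (a%:R * e a) - e a * (b%:R * e b) by ring.
rewrite -!euler_esym_on !mulr_sumr -sumrB -big_split.
apply: eq_bigr => i iS /=.
have := mderiv_esym_exchange R a b iS; rewrite -/e => xchg.
by ring: xchg.
Qed.

Lemma sum_mderiv_esym3_exchange (n : nat) (R : comNzRingType) (S : {set 'I_n})
    (a b c : nat) (e := esym_on R S) :
  sum_mderiv_esym3 R S a b c.+1 =
  sum_mderiv_esym3 R S a.+1 b c +
  (e c * sum_mderiv_esym2 R S a b - e a * sum_mderiv_esym2 R S b c).
Proof.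
rewrite !mulr_sumr -sumrB -big_split.
apply: eq_bigr => i iS /=.
have := mderiv_esym_exchange R a c iS; rewrite -/e => xchg.
by ring: xchg.
Qed.

(** The coefficient that comes out of the exchange is [a - b + 1 + 2 i] in the
    ring; [b <= a] makes the truncated subtraction agree with it. *)
Lemma sum_mderiv_esym2E (n : nat) (R : comNzRingType) (S : {set 'I_n})
    (a b : nat) (e := esym_on R S) :
  (b <= a)%N ->
  sum_mderiv_esym2 R S a b =
  \sum_(0 <= i < b)
     (a - b + 1 + 2 * i)%:R * e (a + i)%N * e (b - 1 - i)%N.
Proof.
elim: b a => [|b IHb] a leba; first by rewrite sum_mderiv_esym2_0 big_geq.
rewrite sum_mderiv_esym2_exchange IHb; last by lia.
rewrite big_nat_recl // addrC -natrB; last by lia.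
congr (_ + _).
  by congr (_%:R * e _ * e _); lia.
by apply: eq_big_nat => i lib; congr (_%:R * e _ * e _); lia.
Qed.

Lemma sum_mderiv_esym3E (n : nat) (R : comNzRingType) (S : {set 'I_n})
    (a b c : nat) (e := esym_on R S) :
  sum_mderiv_esym3 R S a b c =
  \sum_(0 <= j < c)
     (e (c - 1 - j)%N * sum_mderiv_esym2 R S (a + j) b -
      e (a + j)%N * sum_mderiv_esym2 R S b (c - 1 - j)).
Proof.
elim: c a => [|c IHc] a; first by rewrite sum_mderiv_esym3_0 big_geq.
rewrite sum_mderiv_esym3_exchange IHc big_nat_recl // addrC addn0.
rewrite subn0 subSS subn0; congr (_ + _).
apply: eq_big_nat => j ljc.
have -> : (a + j.+1 = a.+1 + j)%N by lia.
by have -> : (c - j.+1 = c - 1 - j)%N by lia.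
Qed.

Lemma Dtilde2_esym_on3 (n : nat) (R : comNzRingType) (S : {set 'I_n})
    (a b c : nat) (e := esym_on R S) :
  Dtilde2 (e a * e b * e c) = 6%:R * sum_mderiv_esym3 R S a b c.
Proof.
rewrite /Dtilde2 (bigID (mem S)) /= [X in _ + X]big1 ?addr0; last first.
  move=> i niS; rewrite mderivn_iter /= 2!mderivM.
  by rewrite !mderiv_esym_on_notin // !(mul0r, mulr0, addr0, mderiv0).
rewrite /sum_mderiv_esym3 mulr_sumr; apply: eq_bigr => i _.
rewrite mderivn_iter /= !(mderivM, mderivD) !mderiv2_esym_on !mderiv0 -/e.
by ring.
Qed.

Theorem lemma5p3 (R : comNzRingType) (n : nat) (hn : (2 <= n)%N)
    (k h l : nat) (hkh : (h <= k)%N) (hhl : (l <= h)%N) (hl : (1 <= l)%N) :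
  let e := esym_tail n R in
  Dtilde2 (e k * e h * e l) =
  6%:R *
  (\sum_(0 <= j < l) \sum_(0 <= i < h)
      (k - h + 1 + j + 2 * i)%:R *
      e (k + i + j)%N * e (h - 1 - i)%N * e (l - 1 - j)%N
   - \sum_(0 <= j < l - 1) \sum_(1 <= i < l - j)
      (h - l + j + 2 * i)%:R *
      e (k + j)%N * e (h - 1 + i)%N * e (l - 1 - i - j)%N).
Proof.
move=> e; rewrite Dtilde2_esym_on3 sum_mderiv_esym3E sumrB.
congr (_ * (_ - _)).
  apply: eq_big_nat => j _; rewrite sum_mderiv_esym2E; last by lia.
  rewrite mulr_sumr; apply: eq_big_nat => i _.
  rewrite mulrC; congr (_%:R * e _ * e _ * e _); lia.
case: l hhl hl => // l hhl _.
(* The term j = l vanishes: one of its factors is a derivative of e 0. *)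
rewrite big_nat_recr //= subSS subn0 subnn sum_mderiv_esym2_0 mulr0 addr0.
apply: eq_big_nat => j ljl; rewrite sum_mderiv_esym2E; last by lia.
rewrite mulr_sumr big_add1 /= subSn /=; last by lia.
apply: eq_big_nat => i _.
rewrite -!mulrA mulrCA; congr (_%:R * (e _ * (e _ * e _))); lia.
Qed.
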